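(* Let $L$ be a completely distributive lattice, let $L^{L}$ be the complete lattice of all order-preserving maps $L\to L$ with the pointwise order, equipped with the co-quantale operation $(g\bullet f)(a)=\bigwedge\{c\in L\mid \exists b\in L:\ b\triangleleft^{co} f(a)\text{ and } c\triangleleft^{co} g(b)\}$, and let $\mathcal{M}(L)\subseteq L^{L}$ be the set of all meet-preserving maps $L\to L$. Then $(\mathcal{M}(L),\circ)$, with $\circ$ the usual composition, is a co-quantale quotient of $(L^{L},\bullet)$; that is, there exists a co-quantale nucleus $j$ on $(L^{L},\bullet)$ such that $\mathcal{M}(L)=(L^{L})_{j}$ and $g\circ f=j(g\bullet f)$ for all $f,g\in\mathcal{M}(L)$.
   Context: In a complete lattice $P$, $x\triangleleft y$ means that for every subset $A\subseteq P$ (possibly empty) with $y\leq\bigvee A$ there is $a\in A$ with $x\leq a$; $x\triangleleft^{co}y$ ($x$ is co-wedge-below $y$) means that for every subset $A\subseteq P$ (possibly empty) with $\bigwedge A\leq y$ there is $a\in A$ with $a\leq x$. A complete lattice $L$ is completely distributive if $x=\bigvee\{y\in L\mid y\triangleleft x\}$ for all $x\in L$. A map is meet-preserving if it preserves arbitrary infima (including the empty one). A co-quantale is a complete lattice with an associative binary operation that distributes over arbitrary infima in each variable; $(L^{L},\bullet)$ is a co-quantale. A co-quantale nucleus on a co-quantale $(Q,\ast)$ is a map $j\colon Q\to Q$ such that for all $a,b\in Q$: (1) $a\leq j(a)$; (2) $a\leq b$ implies $j(a)\leq j(b)$; (3) $j(j(a))=j(a)$; (4) $j(a)\ast j(b)\leq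 j(a\ast b)$. Put $Q_j=\{q\in Q\mid j(q)=q\}$, with operation $a\ast_j b=j(a\ast b)$. A subset $T\subseteq Q$ is a co-quantale quotient of $Q$ if $T=Q_j$ for some co-quantale nucleus $j$ on $Q$. *)

(* Defs.v *)
From HB Require Import structures.
From mathcomp Require Import all_boot all_order.
From mathcomp Require Import boolp classical_sets.

Set Implicit Arguments.
Unset Strict Implicit.
Unset Printing Implicit Defensive.

Import Order.TTheory.

Local Open Scope classical_set_scope.
Local Open Scope order_scope.

(* [infimums set0] and [supremums set0] are the singletons of the greatest and
   of the least element, so bounds and nonemptiness are included. *)
HB.mixin Record POrder_isCompleteLattice d T of Order.POrder d T := {
  Inf : set T -> T;
  Sup : set T -> T;
  Inf_infimums : forall A : set T, infimums A (Inf A);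
  Sup_supremums : forall A : set T, supremums A (Sup A);
}.

#[short(type="completeLatticeType")]
HB.structure Definition CompleteLattice d :=
  {T of Order.POrder d T & POrder_isCompleteLattice d T}.

(* [x ◁co y] places [x] far above [y] (see [cowedge_below_ge]). In both
   relations the set [A] may be empty, so that [\bot ◁ \bot] fails and
   nothing is co-wedge-below the top element. *)
Section CompleteLatticeTheory.
Context {d : Order.disp_t} {T : completeLatticeType d}.
Implicit Types (A B : set T) (x y : T).

Lemma Inf_le A x : A x -> Inf A <= x.
Proof. by move=> Ax; apply: (Inf_infimums A).1. Qed.

Lemma le_Inf A y : (forall x, A x -> y <= x) -> y <= Inf A.
Proof. by move=> h; apply: (Inf_infimums A).2 => x; exact: h. Qed.

Lemma le_Sup A x : A x -> x <= Sup A.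
Proof. by move=> Ax; apply: (Sup_supremums A).1. Qed.

Lemma Sup_le A y : (forall x, A x -> x <= y) -> Sup A <= y.
Proof. by move=> h; apply: (Sup_supremums A).2 => x; exact: h. Qed.

Definition wedge_below x y : Prop :=
  forall A, y <= Sup A -> exists2 a, A a & x <= a.

Definition cowedge_below x y : Prop :=
  forall A, Inf A <= y -> exists2 a, A a & a <= x.

Lemma cowedge_below_le x y y' : y <= y' ->
  cowedge_below x y' -> cowedge_below x y.
Proof. by move=> yy' xy' A Ay; apply: xy'; exact: le_trans Ay yy'. Qed.

Lemma le_cowedge_below x x' y : x <= x' ->
  cowedge_below x y -> cowedge_below x' y.
Proof. by move=> xx' xy A /xy[a Aa ax]; exists a => //; exact: le_trans xx'. Qed.

Lemma cowedge_below_ge x y : cowedge_below x y -> y <= x.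
Proof.
move=> /(_ [set y])[|a -> //].
by apply: Inf_le.
Qed.

End CompleteLatticeTheory.

Notation "x '◁' y" := (wedge_below x y) (at level 70) : order_scope.
Notation "x '◁co' y" := (cowedge_below x y) (at level 70) : order_scope.

HB.mixin Record CompleteLattice_isCompletelyDistributive d T
    of CompleteLattice d T := {
  Sup_wedge_below : forall x : T, x = Sup [set y : T | y ◁ x];
}.

#[short(type="completelyDistrLatticeType")]
HB.structure Definition CompletelyDistrLattice d :=
  {T of CompleteLattice d T & CompleteLattice_isCompletelyDistributive d T}.

Definition meet_preserving d d' (T : completeLatticeType d)
    (T' : completeLatticeType d') (f : T -> T') : Prop :=
  forall A : set T, f (Inf A) = Inf (f @` A).

HB.mixin Record CompleteLattice_isCoQuantale d T of CompleteLattice d T := {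
  comul : T -> T -> T;
  comulA : associative comul;
  comul_Infl : forall b : T, meet_preserving (fun a : T => comul a b);
  comul_Infr : forall a : T, meet_preserving (fun b : T => comul a b);
}.

#[short(type="coQuantaleType")]
HB.structure Definition CoQuantale d :=
  {T of CompleteLattice d T & CompleteLattice_isCoQuantale d T}.

Notation "a • b" := (comul a b) (at level 40, left associativity) : order_scope.

Record coquantale_nucleus d (Q : coQuantaleType d) (j : Q -> Q) : Prop := {
  nucleus_ge : forall a : Q, a <= j a;
  nucleus_homo : forall a b : Q, a <= b -> j a <= j b;
  nucleus_idem : forall a : Q, j (j a) = j a;
  nucleus_comul : forall a b : Q, j a • j b <= j (a • b);
}.

Definition nucleus_fix d (Q : coQuantaleType d) (j : Q -> Q) : set Q :=
  [set q | j q = q].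

Section OrderMorphismPOrder.
Context {d d' : Order.disp_t} {T : porderType d} {T' : porderType d'}.
Implicit Types f g h : {omorphism T -> T'}.

Lemma omorph_inj f g : (f : T -> T') = g -> f = g.
Proof.
case: f g => f [[fP]] [g [[gP]]] /= fg; case: _ / fg in gP *.
by rewrite (Prop_irrelevance fP gP).
Qed.

(* [porderType] requires decidable equality and choice; for order-preserving
   maps both come from the classical axioms of [boolp]. *)
HB.instance Definition _ := gen_eqMixin {omorphism T -> T'}.
HB.instance Definition _ := gen_choiceMixin {omorphism T -> T'}.

Definition leom f g : bool := (f : T -> T') <= g.

Fact leom_refl : reflexive leom. Proof. by move=> f; exact: lexx. Qed.

Fact leom_anti : antisymmetric leom.
Proof. by move=> f g /le_anti; exact: omorph_inj. Qed.

Fact leom_trans : transitive leom.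
Proof. by move=> g f h; exact: le_trans. Qed.

HB.instance Definition _ :=
  Order.Le_isPOrder.Build FunOrder.fun_display {omorphism T -> T'}
    leom_refl leom_anti leom_trans.

Lemma leomP f g : reflect (forall x, f x <= g x) (f <= g).
Proof. exact: lefP. Qed.

End OrderMorphismPOrder.

Section OrderMorphismCompleteLattice.
Context {d d' : Order.disp_t} {T : porderType d} {T' : completeLatticeType d'}.
Implicit Types (F : set {omorphism T -> T'}) (f g : {omorphism T -> T'}).

Definition Infom_fun F (x : T) : T' := Inf [set f x | f in F].

Fact Infom_homo F : {homo Infom_fun F : x y / x <= y}.
Proof.
move=> x y xy; apply: le_Inf => _ [f Ff <-].
by apply: le_trans (omorph_le f xy); apply: Inf_le; exists f.
Qed.

HB.instance Definition _ F :=
  Order.isOrderMorphism.Build d T d' T' (Infom_fun F) (@Infom_homo F).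

Definition Infom F : {omorphism T -> T'} := Infom_fun F.

Definition Supom_fun F (x : T) : T' := Sup [set f x | f in F].

Fact Supom_homo F : {homo Supom_fun F : x y / x <= y}.
Proof.
move=> x y xy; apply: Sup_le => _ [f Ff <-].
by apply: le_trans (omorph_le f xy) _; apply: le_Sup; exists f.
Qed.

HB.instance Definition _ F :=
  Order.isOrderMorphism.Build d T d' T' (Supom_fun F) (@Supom_homo F).

Definition Supom F : {omorphism T -> T'} := Supom_fun F.

Fact Infom_infimums F : infimums F (Infom F).
Proof.
split=> [f Ff|g gF]; apply/leomP => x; first by apply: Inf_le; exists f.
by apply: le_Inf => _ [f Ff <-]; apply/leomP: x; exact: gF.
Qed.

Fact Supom_supremums F : supremums F (Supom F).
Proof.
split=> [f Ff|g gF]; apply/leomP => x; first by apply: le_Sup; exists f.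
by apply: Sup_le => _ [f Ff <-]; apply/leomP: x; exact: gF.
Qed.

HB.instance Definition _ :=
  POrder_isCompleteLattice.Build FunOrder.fun_display {omorphism T -> T'}
    Infom_infimums Supom_supremums.

Lemma InfomE F x : Inf F x = Inf [set f x | f in F].
Proof. by []. Qed.

End OrderMorphismCompleteLattice.

Section OrderMorphismCoQuantale.
Context {d : Order.disp_t} {L : completelyDistrLatticeType d}.
Implicit Types (x y : L) (f g h : {omorphism L -> L}).

Lemma Inf_cowedge_below x : x = Inf [set y | y ◁co x].
Proof.
apply/eqP; rewrite eq_le; apply/andP; split.
  by apply: le_Inf => y; exact: cowedge_below_ge.
set z := Inf _; rewrite [z]Sup_wedge_below; apply: Sup_le => w wz.
apply: contrapT => /negP wx.
have : Sup [set u | ~~ (w <= u)] ◁co x.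
  move=> A Ax; have [a Aa wa] : exists2 a, A a & ~~ (w <= a).
    apply: contrapT => nA; move/negP: wx; apply; apply: le_trans Ax.
    apply: le_Inf => a Aa; apply: contrapT => /negP wa.
    by apply: nA; exists a.
  by exists a => //; exact: le_Sup.
move=> /(@Inf_le _ _ [set y | y ◁co x]) /wz[u /=].
by move=> /negP.
Qed.

Lemma cowedge_below_interpolate x y : x ◁co y ->
  exists2 z, x ◁co z & z ◁co y.
Proof.
move=> /(_ [set u | exists2 z, u ◁co z & z ◁co y])[|u [z uz zy] ux].
  rewrite [leRHS]Inf_cowedge_below; apply: le_Inf => z zy.
  rewrite [leRHS]Inf_cowedge_below; apply: le_Inf => u uz.
  by apply: Inf_le; exists z.
by exists z => //; exact: le_cowedge_below uz.
Qed.

Lemma cowedge_below_Inf x (A : set L) :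
  x ◁co Inf A <-> exists2 a, A a & x ◁co a.
Proof.
split=> [/cowedge_below_interpolate[z xz /(_ A (lexx _))[a Aa az]]|[a Aa]].
  by exists a => //; exact: cowedge_below_le xz.
by apply: cowedge_below_le; exact: Inf_le.
Qed.

(* The operation [g • f], applied as the composition [g \o f]: [f] first. *)
Definition comulom_fun g f (a : L) : L :=
  Inf [set c | exists b : L, b ◁co f a /\ c ◁co g b].

Fact comulom_homo g f : {homo comulom_fun g f : x y / x <= y}.
Proof.
move=> x y xy; apply: le_Inf => c [b [bfy cgb]]; apply: Inf_le; exists b.
by split=> //; apply: cowedge_below_le bfy; exact: omorph_le.
Qed.

HB.instance Definition _ g f :=
  Order.isOrderMorphism.Build d L d L (comulom_fun g f) (@comulom_homo g f).

Definition comulom g f : {omorphism L -> L} := comulom_fun g f.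

Lemma cowedge_below_comulom g f a c :
  c ◁co comulom g f a <-> exists2 b, b ◁co f a & c ◁co g b.
Proof.
split=> [/cowedge_below_Inf[e [b [bfa egb] ce]]|[b bfa cgb]].
  exists b => //; apply: le_cowedge_below egb; exact: cowedge_below_ge.
have [e ce egb] := cowedge_below_interpolate cgb.
by apply/cowedge_below_Inf; exists e => //; exists b.
Qed.

Lemma eq_cowedge_below x y : (forall c, c ◁co x <-> c ◁co y) -> x = y.
Proof.
move=> xy; rewrite [x]Inf_cowedge_below [y]Inf_cowedge_below.
by congr Inf; apply/seteqP; split=> c /xy.
Qed.

Fact comulomA : associative comulom.
Proof.
move=> h g f; apply: omorph_inj; apply/funext => a.
apply: eq_cowedge_below => c; rewrite !cowedge_below_comulom.
split=> [[e /cowedge_below_comulom[b bfa egb] che]|[b bfa]].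
  by exists b => //; apply/cowedge_below_comulom; exists e.
move=> /cowedge_below_comulom[e egb che]; exists e => //.
by apply/cowedge_below_comulom; exists b.
Qed.

Lemma cowedge_below_Infom c (F : set {omorphism L -> L}) a :
  c ◁co Infom F a <-> exists2 f : {omorphism L -> L}, F f & c ◁co f a.
Proof.
rewrite (cowedge_below_Inf c [set f a | f in F]); split.
  by move=> [_ [f Ff <-] cfa]; exists f.
by move=> [f Ff cfa]; exists (f a) => //; exists f.
Qed.

Fact comulom_Infl f : meet_preserving (fun g => comulom g f).
Proof.
move=> G; apply: omorph_inj; apply/funext => a; apply: eq_cowedge_below => c.
split=> [/cowedge_below_comulom[b bfa /cowedge_below_Infom[g Gg cgb]]|].
  apply/cowedge_below_Infom; exists (comulom g f); first by exists g.
  by apply/cowedge_below_comulom; exists b.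
move=> /cowedge_below_Infom[_ [g Gg <-]] /cowedge_below_comulom[b bfa cgb].
apply/cowedge_below_comulom; exists b => //.
by apply/cowedge_below_Infom; exists g.
Qed.

Fact comulom_Infr g : meet_preserving (fun f => comulom g f).
Proof.
move=> F; apply: omorph_inj; apply/funext => a; apply: eq_cowedge_below => c.
split=> [/cowedge_below_comulom[b /cowedge_below_Infom[f Ff bfa] cgb]|].
  apply/cowedge_below_Infom; exists (comulom g f); first by exists f.
  by apply/cowedge_below_comulom; exists b.
move=> /cowedge_below_Infom[_ [f Ff <-]] /cowedge_below_comulom[b bfa cgb].
apply/cowedge_below_comulom; exists b => //.
by apply/cowedge_below_Infom; exists f.
Qed.

HB.instance Definition _ :=
  CompleteLattice_isCoQuantale.Build FunOrder.fun_display {omorphism L -> L}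
    comulomA comulom_Infl comulom_Infr.

Lemma comulomE g f a :
  (g • f) a = Inf [set c | exists b : L, b ◁co f a /\ c ◁co g b].
Proof. by []. Qed.

End OrderMorphismCoQuantale.

Definition meet_preserving_maps d (L : completeLatticeType d) :
  set {omorphism L -> L} := [set f | meet_preserving f].
Arguments meet_preserving_maps {d} L.

(* Main.v *)
(* The nucleus is [j f = f • id], i.e. [j f a] is the meet of the [f b] for
   [b ◁co a]. The identity is a left unit for [•] but not a right unit, so
   associativity gives [j g • j f = g • (id • f) • id = j (g • f)] and the
   idempotence of [j]. Interpolation makes every [f • id] meet-preserving, and a
   meet-preserving [f] satisfies [f • id = f] because [a] is the meet of the
   [b ◁co a]. Finally [(g • f) a = (g • id) (f a)] by definition. *)
Require Import Defs.
From mathcomp Require Import all_boot all_order.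
From mathcomp Require Import boolp classical_sets.

Import Order.TTheory.

Local Open Scope classical_set_scope.
Local Open Scope order_scope.

Section ComulId.
Context {d : Order.disp_t} {L : completelyDistrLatticeType d}.
Implicit Types (f g h : {omorphism L -> L}) (a c : L).

Let id_om : {omorphism L -> L} := idfun.

(** By transitivity and interpolation of [◁co], inserting an intermediate [b] between [c] and [f a]
    changes nothing. *)
Lemma comul_idl f : id_om • f = f.
Proof.
apply: omorph_inj; apply/funext => a; apply: eq_cowedge_below => c.
split=> [/cowedge_below_comulom[b bfa cb]|].
  apply: cowedge_below_le cb; exact: cowedge_below_ge.
move=> /cowedge_below_interpolate[b cb bfa].
by apply/cowedge_below_comulom; exists b.
Qed.

Lemma comul_idr_ge f : f <= f • id_om.
Proof.
apply/leomP => a; apply: le_Inf => c [b [ba cfb]].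
by apply: le_trans (cowedge_below_ge cfb); apply/omorph_le/cowedge_below_ge.
Qed.

Lemma le_comull f g h : f <= g -> f • h <= g • h.
Proof.
move=> /leomP fg; apply/leomP => a; apply: le_Inf => c [b [ba cgb]].
by apply: Inf_le; exists b; split=> //; apply: cowedge_below_le cgb; exact: fg.
Qed.

(** Only values [f b] with [b ◁co Inf A] enter, and each such [b] is already co-wedge-below a member
    of [A]. *)
Lemma comul_idr_meet_preserving f : meet_preserving (f • id_om).
Proof.
move=> A; apply: eq_cowedge_below => c; split.
  move=> /cowedge_below_comulom[b /cowedge_below_Inf[a Aa ba] cfb].
  apply/cowedge_below_Inf; exists ((f • id_om) a); first by exists a.
  by apply/cowedge_below_comulom; exists b.
move=> /cowedge_below_Inf[_ [a Aa <-] /cowedge_below_comulom[b ba cfb]].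
apply/cowedge_below_comulom; exists b => //.
by apply/cowedge_below_Inf; exists a.
Qed.

Lemma meet_preserving_comul_idr f : meet_preserving f -> f • id_om = f.
Proof.
move=> fM; apply: omorph_inj; apply/funext => a; apply: eq_cowedge_below => c.
(* Turns the right-hand [f a] into the meet of the [f b] with [b ◁co a]. *)
rewrite [in f a](Inf_cowedge_below a) fM; split.
  move=> /cowedge_below_comulom[b ba cfb].
  by apply/cowedge_below_Inf; exists (f b) => //; exists b.
move=> /cowedge_below_Inf[_ [b ba <-] cfb].
by apply/cowedge_below_comulom; exists b.
Qed.

Lemma comul_idr_nucleus :
  coquantale_nucleus (fun f : {omorphism L -> L} => f • id_om).
Proof.
split=> [f|f g|f|g f]; first exact: comul_idr_ge.
- exact: le_comull.
- by rewrite -comulA comul_idl.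
- by rewrite -comulA [id_om • _]comulA comul_idl comulA.
Qed.

End ComulId.

Theorem theorem4p14 (d : Order.disp_t) (L : completelyDistrLatticeType d) :
  exists j : {omorphism L -> L} -> {omorphism L -> L},
    [/\ coquantale_nucleus j,
        meet_preserving_maps L = nucleus_fix j
      & forall f g : {omorphism L -> L},
          meet_preserving_maps L f -> meet_preserving_maps L g ->
          g \o f = j (g • f) :> (L -> L)].
Proof.
exists (fun f => f • (idfun : {omorphism L -> L})); split.
- exact: comul_idr_nucleus.
- apply/seteqP; split=> f; first exact: meet_preserving_comul_idr.
  by move=> /= <-; exact: comul_idr_meet_preserving.
- move=> f g /meet_preserving_comul_idr fE /meet_preserving_comul_idr gE.
  (* Reassociated, the outer identity is absorbed by [f]; once [g] is expanded to [g • id], both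
     sides are convertible. *)
  by rewrite -comulA fE; apply/funext => a; rewrite -[in LHS]gE.
Qed.
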